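(* Let $(\Omega,\mathcal F,(\mathcal F_t)_{0\le t\le T},P)$ be a stochastic basis with $\mathcal F=\mathcal F_T$, let $S_t=S_0\mathrm e^{H_t}$, $0\le t\le T$, with $S_0>0$ be an asset price modeled as an exponential semimartingale satisfying the martingale condition (see context), let $X=(X_t)_{0\le t\le T}$ be the underlying process (see context), let $f:\mathbb R\to\mathbb R_+$ be a Borel measurable payoff function, and put $\mathsf{s}:=-\log S_0\in\mathbb R$. Let $R\in\mathbb R$ and let $g(x)=\mathrm e^{-Rx}f(x)$, $x\in\mathbb R$. Assume that 1. $g$ is bounded, continuous and belongs to $L^1(\mathbb R)$; 2. $M_{X_T}(R)=E[\mathrm e^{RX_T}]$ exists (is finite); 3. $\widehat g\in L^1(\mathbb R)$. Then the time-$0$ price function $\mathbb V_f(X;\mathsf s)=E[f(X_T-\mathsf s)]$ is given by $$\mathbb V_f(X;\mathsf s)=\frac{\mathrm e^{-R\mathsf s}}{2\pi}\int_{\mathbb R}\mathrm e^{-iu\mathsf s}\,\varphi_{X_T}(u-iR)\,\widehat f(iR-u)\,\mathrm du .$$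
   Context: Model. $H=(H_t)_{0\le t\le T}$ is a real-valued semimartingale on the stochastic basis with $H_0=0$ and canonical representation $H=B+H^c+h(x)*(\mu-\nu)+(x-h(x))*\mu$, where $h$ is a truncation function, $B$ is a predictable process of bounded variation, $H^c$ is the continuous martingale part with $\langle H^c\rangle=C$, $\mu$ is the random measure of jumps of $H$ and $\nu$ its predictable compensator; $*$ denotes the (stochastic) integral process with respect to a random measure. It is assumed that $1_{\{x>1\}}\mathrm e^x*\nu$ has bounded variation and that the martingale condition holds: $B+\frac C2+(\mathrm e^x-1-h(x))*\nu=0$ (equivalently, $S=S_0\mathrm e^H$ is a local martingale under $P$). Interest rate and dividend yield are zero. Underlying process. $X=(X_t)_{0\le t\le T}$ is an adapted real-valued process of the form $X_t=\Psi(H_s,\,0\le s\le t)$ for a measurable functional $\Psi$, with $X_0=0$ (for example $X=H$, or the running supremum or infimum of $H$). The option payoff at maturity $T$ is $f(X_T-\mathsf s)$, and its time-$0$ price, as a function of $\mathsf s=-\log S_0$, is $\mathbb V_f(X;\mathsf s)=E[f(X_T-\mathsf s)]$, the expectation being under $P$. Notation. $M_{X_T}(u)=E[\mathrm e^{uX_T}]=\varphi_{X_T}(-iu)$ is the moment generating function and $\varphi_{X_T}$ the extended characteristic function, so $\varphi_{X_T}(z)=E[\mathrm e^{izX_T}]$ for those $z\in\mathbb C$ for which it is defined. The (extended) Fourier transform is $\widehat f(z)=\int_{\mathbb R}\mathrm e^{izx}f(x)\,\mathrm dx$ for those $z\in\mathbb C$ for which the integral converges absolutely; in particular $\widehat g(u)=\widehat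 f(u+iR)$ for $u\in\mathbb R$. *)

(* Defs.v *)
From HB Require Import structures.
From mathcomp Require Import all_boot all_order all_algebra.
From mathcomp Require Export complex.
From mathcomp Require Import all_classical all_reals all_analysis.
From mathcomp Require Import measurable_realfun.

Set Implicit Arguments.
Unset Strict Implicit.
Unset Printing Implicit Defensive.

Import Order.TTheory GRing.Theory Num.Theory.
Import numFieldNormedType.Exports.

Local Open Scope classical_set_scope.
Local Open Scope ring_scope.
Local Open Scope complex_scope.

Section complex_integration.
Context {R : realType}.

Definition cexp (z : R[i]) : R[i] :=
  (expR (complex.Re z))%:C * (cos (complex.Im z) +i* sin (complex.Im z)).

Definition Cintegrable d (T : measurableType d)
    (mu : {measure set T -> \bar R}) (f : T -> R[i]) : Prop :=
  mu.-integrable setT (fun x => (complex.Re (f x))%:E) /\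
  mu.-integrable setT (fun x => (complex.Im (f x))%:E).

(* Meaningful only when [Cintegrable mu f] holds. *)
Definition Cintegral d (T : measurableType d)
    (mu : {measure set T -> \bar R}) (f : T -> R[i]) : R[i] :=
  (\int[mu]_x complex.Re (f x)) +i* (\int[mu]_x complex.Im (f x)).

Definition fourier_kernel (f : R -> R) (z : R[i]) (x : R) : R[i] :=
  cexp ('i%C * z * x%:C) * (f x)%:C.

Definition fourier_defined (f : R -> R) (z : R[i]) : Prop :=
  Cintegrable (@lebesgue_measure R) (fourier_kernel f z).

Definition fourier (f : R -> R) (z : R[i]) : R[i] :=
  Cintegral (@lebesgue_measure R) (fourier_kernel f z).

Definition charfun_defined d (T : measurableType d) (P : probability T R)
    (Y : T -> R) (z : R[i]) : Prop :=
  Cintegrable P (fun w => cexp ('i%C * z * (Y w)%:C)).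

Definition charfun d (T : measurableType d) (P : probability T R)
    (Y : T -> R) (z : R[i]) : R[i] :=
  Cintegral P (fun w => cexp ('i%C * z * (Y w)%:C)).

Definition price d (T : measurableType d) (P : probability T R)
    (f : R -> R) (Y : T -> R) (s : R) : \bar R :=
  ('E_P[(fun w => f (Y w - s))%R])%E.

End complex_integration.

Section paths.
Context {R : realType}.
Implicit Types (y : R -> R) (T t : R).

Definition cadlag T y : Prop :=
  (forall t, 0 <= t < T -> y u @[u --> t^'+] --> y t) /\
  (forall t, 0 < t <= T -> cvg (y u @[u --> t^'-])).

Definition left_continuous T y : Prop :=
  forall t, 0 < t <= T -> y u @[u --> t^'-] --> y t.

(* Convention y(0-) = y(0), so that there is no jump at time 0. *)
Definition jump y t : R := if 0 < t then y t - lim (y u @[u --> t^'-]) else 0.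

(* The sigma-algebra generated by the coordinates y(s), s in [0, t], on the
   space of functions that are cadlag on [0, t].  Functions are defined on all
   of R, but a measurable functional only sees their restriction to [0, t]. *)
Definition path_sigma t : set (set (R -> R)) :=
  <<s [set y | cadlag t y],
      \bigcup_(u in [set u | 0 <= u <= t])
        preimage_set_system [set y | cadlag t y] (fun y => y u) measurable >>.

Definition truncation_function (h : R -> R) : Prop :=
  [/\ measurable_fun setT h, [bounded h x | x in setT] &
      \forall x \near (0 : R), h x = x].

End paths.

(* Processes are functions R -> Omega -> R of which only the times in [0, T]
   matter.  The definitions follow Jacod and Shiryaev, Limit Theorems for
   Stochastic Processes, transposed to the time set [0, T]. *)
Section stochastic_processes.
Context {d : measure_display} {Omega : measurableType d} {R : realType}.
Variables (P : probability Omega R) (T : R) (F : R -> set (set Omega)).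
Implicit Types (Y M N A B C H : R -> Omega -> R).

Record stochastic_basis : Prop := StochasticBasis {
  sb_sigma : forall t, 0 <= t <= T -> sigma_algebra setT (F t);
  sb_sub : forall t, 0 <= t <= T -> F t `<=` measurable;
  sb_mono : forall s t, 0 <= s -> s <= t -> t <= T -> F s `<=` F t;
  sb_right_continuous : forall t, 0 <= t < T ->
    F t = \bigcap_(u in [set u | t < u <= T]) F u }.

Definition adapted Y : Prop := forall t, 0 <= t <= T ->
  preimage_set_system setT (Y t) measurable `<=` F t.

Definition cadlag_process Y : Prop := forall w, cadlag T (Y ^~ w).

Definition continuous_process Y : Prop :=
  forall w, {within `[0, T], continuous (Y ^~ w)}.

Definition finite_variation_process A : Prop :=
  [/\ adapted A, cadlag_process A, forall w, A 0 w = 0 &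
      forall w, bounded_variation 0 T (A ^~ w)].

(* The last clause says E[M_t | F_s] = M_s, by the defining property of
   conditional expectation. *)
Definition martingale M : Prop :=
  [/\ adapted M, cadlag_process M,
      forall t, 0 <= t <= T -> P.-integrable setT (EFin \o M t) &
      forall s t (A : set Omega), 0 <= s -> s <= t -> t <= T -> F s A ->
        (\int[P]_(w in A) (M t w)%:E = \int[P]_(w in A) (M s w)%:E)%E].

(* Any value greater than T plays the role of +oo. *)
Definition stopping_time (tau : Omega -> R) : Prop :=
  (forall w, 0 <= tau w) /\
  (forall t, 0 <= t <= T -> F t [set w | tau w <= t]).

Definition stopped (tau : Omega -> R) Y : R -> Omega -> R :=
  fun t w => Y (Num.min t (tau w)) w.

(* On the closed time interval [0, T], a localizing sequence has to reach T
   almost surely after finitely many steps. *)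
Definition local_martingale M : Prop :=
  [/\ adapted M, cadlag_process M &
      exists tau : nat -> Omega -> R,
        [/\ forall n, stopping_time (tau n),
            forall w, nondecreasing_seq (tau ^~ w),
            {ae P, forall w, exists n, T <= tau n w} &
            forall n, martingale (stopped (tau n) M)]].

Definition continuous_local_martingale M : Prop :=
  [/\ local_martingale M, continuous_process M & forall w, M 0 w = 0].

Definition purely_discontinuous_local_martingale M : Prop :=
  [/\ local_martingale M, forall w, M 0 w = 0 &
      forall N, local_martingale N -> continuous_process N ->
        local_martingale (fun t w => M t w * N t w)].

Definition semimartingale H : Prop :=
  exists M A, [/\ local_martingale M, forall w, M 0 w = 0,
    finite_variation_process A &
    {ae P, forall w, forall t, 0 <= t <= T ->
      H t w = H 0 w + M t w + A t w}]
    /\ adapted H /\ cadlag_process H.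

Definition time_space : set (R * Omega) := [set p | 0 <= p.1 <= T].

Definition predictable_sigma : set (set (R * Omega)) :=
  <<s time_space,
      \bigcup_(Y in [set Y | adapted Y /\
                             forall w, left_continuous T (Y ^~ w)])
        preimage_set_system time_space (fun p => Y p.1 p.2) measurable >>.

Definition predictable Y : Prop :=
  preimage_set_system time_space (fun p => Y p.1 p.2) measurable
    `<=` predictable_sigma.

Definition epredictable (Y : R -> Omega -> \bar R) : Prop :=
  preimage_set_system time_space (fun p => Y p.1 p.2) measurable
    `<=` predictable_sigma.

(* C = <M> for a continuous local martingale M. *)
Definition quadratic_characteristic M C : Prop :=
  [/\ finite_variation_process C, predictable C,
      forall w s t, 0 <= s -> s <= t -> t <= T -> C s w <= C t w &
      local_martingale (fun t w => M t w ^+ 2 - C t w)].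

Definition random_measure : Type :=
  Omega -> {measure set (R * R)%type -> \bar R}.

(* The integral process W * nu.  A signed integrand that is not integrable
   gets an infinite value, so that an equation between W * nu and a finite
   quantity entails integrability. *)
Definition rm_integral (nu : random_measure) (W : R -> Omega -> R -> R)
    (t : R) (w : Omega) : \bar R :=
  (\int[nu w]_(z in [set z : R * R | (0 <= z.1 <= t)%R])
     (W z.1 w z.2)%:E)%E.

(* The integral of W(t, .) with respect to nu({t} x dx). *)
Definition rm_section (nu : random_measure) (W : R -> Omega -> R -> R)
    (t : R) (w : Omega) : \bar R :=
  (\int[nu w]_(z in [set z : R * R | z.1 = t]) (W z.1 w z.2)%:E)%E.

Definition rm_bounded_variation (nu : random_measure)
    (W : R -> Omega -> R -> R) : Prop :=
  {ae P, forall w,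
    (nu w).-integrable [set z : R * R | 0 <= z.1 <= T]
      (fun z => (W z.1 w z.2)%:E) /\
    bounded_variation 0 T (fun t => fine (rm_integral nu W t w))}.

Definition jump_measure H (mu : random_measure) : Prop :=
  forall w (A : set (R * R)), measurable A ->
    (mu w A = \esum_(s in [set s : R | (0 <= s <= T)%R /\
                                       jump (H ^~ w) s != 0%R])
                \d_(s, jump (H ^~ w) s) A)%E.

(* Functions of (t, w, x) measurable for the product of the predictable
   sigma-algebra and the Borel sigma-algebra. *)
Definition predictable_function (W : R -> Omega -> R -> R) : Prop :=
  preimage_set_system (time_space `*` setT)
      (fun q : (R * Omega) * R => W q.1.1 q.1.2 q.2) measurable
    `<=` <<s time_space `*` setT,
             [set A `*` B | A in predictable_sigma &
                            B in (measurable : set (set R))] >>.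

Record predictable_compensator (mu nu : random_measure) : Prop :=
  PredictableCompensator {
  pc_time : forall w, nu w [set z : R * R | z.1 <= 0 \/ T < z.1] = 0%E;
  pc_predictable : forall W, (forall t w x, 0 <= W t w x) ->
    predictable_function W -> epredictable (rm_integral nu W);
  pc_compensator : forall W, (forall t w x, 0 <= W t w x) ->
    predictable_function W ->
    (\int[P]_w rm_integral mu W T w = \int[P]_w rm_integral nu W T w)%E }.

(* M = W * (mu - nu): the purely discontinuous local martingale whose jump at
   each time t is the difference of the integrals of W over {t} x R. *)
Definition compensated_integral (mu nu : random_measure)
    (W : R -> Omega -> R -> R) M : Prop :=
  purely_discontinuous_local_martingale M /\
  {ae P, forall w, forall t, 0 <= t <= T ->
    ((jump (M ^~ w) t)%:E = rm_section mu W t w - rm_section nu W t w)%E}.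

(* H = B + Hc + Hd + (x - h(x)) * mu, where Hd = h(x) * (mu - nu). *)
Record canonical_representation (h : R -> R) H B Hc Hd C
    (mu nu : random_measure) : Prop := CanonicalRepresentation {
  cr_drift : finite_variation_process B;
  cr_drift_predictable : predictable B;
  cr_continuous_part : continuous_local_martingale Hc;
  cr_bracket : quadratic_characteristic Hc C;
  cr_jump_measure : jump_measure H mu;
  cr_compensator : predictable_compensator mu nu;
  cr_small_jumps : compensated_integral mu nu (fun _ _ x => h x) Hd;
  cr_decomposition : {ae P, forall w, forall t, 0 <= t <= T ->
    ((H t w)%:E = (B t w + Hc t w + Hd t w)%:E +
                  rm_integral mu (fun _ _ x => (x - h x)%R) t w)%E} }.

Definition martingale_condition (h : R -> R) B C (nu : random_measure) : Prop :=
  {ae P, forall w, forall t, 0 <= t <= T ->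
    ((B t w + C t w / 2)%:E +
       rm_integral nu (fun _ _ x => (expR x - 1 - h x)%R) t w = 0)%E}.

Definition path_functional H X : Prop :=
  exists Psi : R -> (R -> R) -> R,
    (forall t, 0 <= t <= T ->
      preimage_set_system [set y | cadlag t y] (Psi t) measurable
        `<=` path_sigma t) /\
    (forall t w, 0 <= t <= T -> X t w = Psi t (H ^~ w)).

End stochastic_processes.

(* Main.v *)
Require Import Defs.
From mathcomp Require Import all_boot all_order all_algebra.
From mathcomp Require Import all_classical all_reals all_analysis.
From mathcomp Require Import measurable_realfun.
From mathcomp Require Import ring lra.

Import Order.TTheory GRing.Theory Num.Theory.
Import numFieldNormedType.Exports.

Local Open Scope classical_set_scope.
Local Open Scope ring_scope.
Local Open Scope complex_scope.

(** Abel summation: the kernel [exp (- e |u|)] has Fourier transform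
    [2 e / (e^2 + a^2)], a rescaled Cauchy density of mass [2 pi].  Inserting
    it in the inversion integral of [g], exchanging the integrals and letting
    [e] tend to [0] gives [g] back at every point by dominated convergence.
    Since [f y = exp (r y) g y], the price is [exp (- r s)] times the
    expectation of [exp (r X_T) g (X_T - s)]; inserting the inversion formula
    for [g] and exchanging expectation and integral gives the real part of the
    claim.  The imaginary part of the integrand is odd in [u]. *)

(** * Fubini and dominated convergence for real-valued integrals *)

(** A product bound with integrable factors makes [f] integrable for the product measure, by
    Tonelli. As it holds at every point, every section is integrable, not merely almost every one;
    all inner integrals are then finite and Fubini passes to real-valued integrals. *)
Lemma Rfubini_dominated (d1 d2 : measure_display) (T1 : measurableType d1)
    (T2 : measurableType d2) (R : realType)
    (m1 : {sigma_finite_measure set T1 -> \bar R})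
    (m2 : {sigma_finite_measure set T2 -> \bar R})
    (f : T1 -> T2 -> R) (a : T1 -> R) (b : T2 -> R) :
  measurable_fun setT (fun p : T1 * T2 => f p.1 p.2) ->
  m1.-integrable setT (EFin \o a) -> m2.-integrable setT (EFin \o b) ->
  (forall x y, `|f x y| <= a x * b y) ->
  [/\ forall x, m2.-integrable setT (EFin \o f x),
      m1.-integrable setT (fun x => (\int[m2]_y f x y)%:E) &
      \int[m1]_x \int[m2]_y f x y = \int[m2]_y \int[m1]_x f x y].
Proof.
move=> mf ia ib fab.
have mb : measurable_fun setT b.
  by apply/measurable_EFinP; exact: measurable_int ib.
have i2 x : m2.-integrable setT (EFin \o f x).
  apply: (@le_integrable _ _ _ m2 setT measurableT _
    (fun y => (a x)%:E * (b y)%:E)%E).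
  - by apply/measurable_EFinP; exact: measurableT_comp mf (pair1_measurable x).
  - by move=> y _; rewrite /= lee_fin (le_trans (fab x y))// ler_norm.
  - exact: integrableZl.
have i1 y : m1.-integrable setT (EFin \o f ^~ y).
  apply: (@le_integrable _ _ _ m1 setT measurableT _
    (fun x => (b y)%:E * (a x)%:E)%E).
  - by apply/measurable_EFinP; exact: measurableT_comp mf (pair2_measurable y).
  - by move=> x _; rewrite /= lee_fin (le_trans (fab x y))// mulrC ler_norm.
  - exact: integrableZl.
pose F (p : T1 * T2) := (f p.1 p.2)%:E.
have iF : (m1 \x m2)%E.-integrable setT F.
  apply/integrable12ltyP; first exact/measurable_EFinP.
  apply: (@le_lt_trans _ _
    (\int[m1]_x ((\int[m2]_y `|b y|)%R%:E * `|(a x)%:E|))%E).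
    apply: ge0_le_integral => //.
    - by move=> x _; exact: integral_ge0.
    - apply: (measurable_fun_fubini_tonelli_F (abse \o F)) => //=.
      by apply: measurableT_comp => //; exact/measurable_EFinP.
    - apply: measurable_funeM; apply: measurableT_comp => //.
      exact: measurable_int ia.
    - move=> x _; rewrite muleC.
      rewrite /Rintegral fineK; last first.
        by apply: integrable_fin_num => //; exact: integrable_abse ib.
      rewrite -ge0_integralZl//; last first.
        exact/measurable_EFinP/measurableT_comp.
      apply: ge0_le_integral => //.
      + apply: measurableT_comp => //; exact: measurable_int (i2 x).
      + apply: measurable_funeM.
        exact/measurable_EFinP/measurableT_comp.
      + move=> y _; rewrite /F/= lee_fin (le_trans (fab x y))// -normrM.
        exact: ler_norm.
  rewrite ge0_integralZl//; last 2 first.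
  - by apply: measurableT_comp => //; exact: measurable_int ia.
  - by rewrite lee_fin Rintegral_ge0.
  move: ia => /integrableP[_ ia]; apply: lte_mul_pinfty => //.
  by rewrite lee_fin Rintegral_ge0.
split => //.
- have := integrable_fubini_F iF.
  apply: eq_integrable => // x _.
  by rewrite /fubini_F /Rintegral fineK//; exact: integrable_fin_num (i2 x).
- have := Fubini iF; rewrite /Rintegral => FF.
  congr fine.
  rewrite (_ : (fun x => _) = fun x => (\int[m2]_y F (x, y))%E); last first.
    by apply/funext => x; rewrite fineK//; exact: integrable_fin_num (i2 x).
  rewrite FF; apply: eq_integral => y _.
  by rewrite fineK//; exact: integrable_fin_num (i1 y).
Qed.

Lemma Rdominated_cvg (d : measure_display) (T : measurableType d)
    (R : realType) (mu : {measure set T -> \bar R})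
    (f_ : nat -> T -> R) (f G : T -> R) :
  (forall n, measurable_fun setT (f_ n)) -> measurable_fun setT f ->
  (forall x, f_ n x @[n --> \oo] --> f x) ->
  mu.-integrable setT (EFin \o G) -> (forall n x, `|f_ n x| <= G x) ->
  \int[mu]_x f_ n x @[n --> \oo] --> \int[mu]_x f x.
Proof.
move=> mf_ mf ff iG fG.
have := @dominated_convergence _ _ _ mu setT measurableT
  (fun n => EFin \o f_ n) (EFin \o f) (EFin \o G).
case.
- by move=> n; exact/measurable_EFinP.
- exact/measurable_EFinP.
- by apply: aeW => x _; apply: cvg_EFin; [exact: nearW|exact: ff].
- exact: iG.
- by apply: aeW => x n _; rewrite /= lee_fin.
- move=> i_f _ h; apply: fine_cvg.
  by rewrite fineK//; exact: integrable_fin_num i_f.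
Qed.

(** * Affine substitution and reflection in Lebesgue integrals *)

(** Lebesgue measure agrees on half-open intervals with [a] times its image under [phi], hence
    everywhere by uniqueness; the formula is then integration against an image measure. *)
Lemma ge0_integral_affine (R : realType) (a b : R) (f : R -> \bar R) :
  0 < a -> measurable_fun setT f -> (forall x, 0 <= f x)%E ->
  let mu := @lebesgue_measure R in
  (\int[mu]_x f x = a%:E * \int[mu]_x f (b + a * x)%R)%E.
Proof.
move=> a0 mf f0 mu.
pose phi (x : R) : measurableTypeR R := b + a * x.
have mphi : measurable_fun setT phi.
  by apply: measurable_funD => //; exact: measurable_funM.
pose nu : {measure set (measurableTypeR R) -> \bar R} :=
  measure_function_pushforward__canonical__measure_function_Measure mu mphi.
have muE (A : set (measurableTypeR R)) : measurable A -> mu A =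
    mscale (NngNum (ltW a0)) nu A.
  apply: lebesgue_measure_unique => _ [[p q]] _ <-.
  rewrite -[RHS]/(a%:E * mu (phi @^-1` `]p, q]))%E.
    have -> : phi @^-1` `]p, q] = `](p - b) / a, (q - b) / a]%classic.
    apply/seteqP; split => x /=; rewrite !in_itv/= /phi;
    by rewrite ltr_pdivrMr// ler_pdivlMr// ltrBlDl lerBrDl (mulrC x).
  rewrite [LHS]lebesgue_measure_itv [X in (_ * X)%E]lebesgue_measure_itv/=.
  rewrite !lte_fin ltr_pM2r ?invr_gt0// ltrD2r.
  case: ifPn => _; last by rewrite mule0.
  rewrite -!EFinD -EFinM; congr EFin.
  by field; rewrite gt_eqF.
transitivity (\int[mscale (NngNum (ltW a0)) nu]_x f x)%E.
  by apply: eq_measure_integral => A mA _; exact: muE.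
rewrite ge0_integral_mscale//=; congr (_ * _)%E.
by rewrite ge0_integral_pushforward// => x _.
Qed.

Lemma Rintegral_affine (R : realType) (a b : R) (f : R -> R) :
  0 < a -> measurable_fun setT f ->
  let mu := @lebesgue_measure R in
  \int[mu]_x f x = \int[mu]_x (a * f (b + a * x)).
Proof.
move=> a0 /measurable_EFinP mf mu.
suff fE : (\int[mu]_x (f x)%:E = \int[mu]_x (a * f (b + a * x))%:E)%E.
  by rewrite /Rintegral fE.
rewrite [LHS]integralE [RHS]integralE.
have mphi : measurable_fun setT (fun x : R => b + a * x).
  by apply: measurable_funD => //; exact: measurable_funM.
congr (_ - _)%E.
- rewrite (@ge0_integral_affine R a b)//; last first.
    exact: measurable_funepos.
  rewrite -ge0_integralZl ?lee_fin ?ltW//.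
    apply: eq_integral => x _.
    by rewrite !funeposE/= -!EFin_max -EFinM maxr_pMr ?ltW// mulr0.
  exact: (measurableT_comp (measurable_funepos mf) mphi).
- rewrite (@ge0_integral_affine R a b)//; last first.
    exact: measurable_funeneg.
  rewrite -ge0_integralZl ?lee_fin ?ltW//.
    apply: eq_integral => x _.
    by rewrite !funenegE/= -!EFin_max -EFinM maxr_pMr ?ltW// mulr0 mulrN.
  exact: (measurableT_comp (measurable_funeneg mf) mphi).
Qed.

(** Lebesgue measure is invariant under reflection, and reflection exchanges the positive and
    negative parts of an odd function. *)
Lemma Rintegral_odd (R : realType) (f : R -> R) :
  measurable_fun setT f -> (forall x, f (- x) = - f x) ->
  \int[@lebesgue_measure R]_x f x = 0.
Proof.
move=> mf fN; rewrite /Rintegral integralE.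
suff -> : (\int[@lebesgue_measure R]_x (EFin \o f)^\- x =
           \int[@lebesgue_measure R]_x (EFin \o f)^\+ x)%E.
  (* If the common value is infinite, the difference is infinite as well and [fine] sends it to
     0. *)
  by case: (\int[_]_x _)%E => //= r; rewrite subrr.
have mN : measurable_fun setT (-%R : R -> measurableTypeR R) by [].
pose nu : {measure set (measurableTypeR R) -> \bar R} :=
  measure_function_pushforward__canonical__measure_function_Measure
    (@lebesgue_measure R) mN.
transitivity (\int[nu]_x (EFin \o f)^\- x)%E.
  by apply: eq_measure_integral => A mA _; exact/esym/lebesgue_measureN.
rewrite ge0_integral_pushforward//; last first.
  by apply: measurable_funeneg; exact/measurable_EFinP.
by apply: eq_integral => x _ /=; rewrite funenegE funeposE /= fN opprK.
Qed.

(** * The Abel kernel and its cosine transform *)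

Section abel_kernel.
Context {R : realType}.
Local Notation mu := (@lebesgue_measure R).

Let continuous_expN (e : R) : continuous (fun u : R => expR (- (e * u))).
Proof.
move=> u; apply: continuous_comp; last exact: continuous_expR.
by apply: continuousN; exact: mulrl_continuous.
Qed.

Let continuous_cosM (a : R) : continuous (fun u : R => cos (u * a)).
Proof.
move=> u; apply: continuous_comp; last exact: continuous_cos.
exact: mulrr_continuous.
Qed.

Let cvg_expN (e : R) : 0 < e -> expR (- (e * u)) @[u --> +oo] --> (0 : R).
Proof.
move=> e0; apply: (@cvg_comp _ _ _ (fun u => e * u) (fun u => expR (- u)) _
  (pinfty_nbhs R)); last exact: cvgr_expR.
exact: gt0_cvgMry.
Qed.

(** Antiderivative of [expR (- (e * u)) * (1 + cos (u * a))] vanishing at infinity. The second term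
    is the real part of exp((-e + ia)u) / (-e + ia). *)
Let F e a (u : R) : R := - (expR (- (e * u)) / e) +
   expR (- (e * u)) * ((a * sin (u * a) - e * cos (u * a)) / (e ^+ 2 + a ^+ 2)).

Let is_derive_F (e a u : R) : 0 < e ->
  is_derive u (1 : R) (F e a) (expR (- (e * u)) * (1 + cos (u * a))).
Proof.
move=> e0.
have e0' : e != 0 by rewrite gt_eqF.
have ea0 : e ^+ 2 + a ^+ 2 != 0.
  by rewrite gt_eqF// ltr_wpDr ?sqr_ge0// exprn_gt0.
have dl : is_derive u (1 : R) (fun v : R => v * a) a.
  by apply: is_derive_eq; rewrite scaler0 add0r /GRing.scale/= mulr1.
have dE : is_derive u (1 : R) (fun v : R => expR (- (e * v)))
    (expR (- (e * u)) * - e).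
  apply: (is_derive1_comp (f := expR) (g := fun v : R => - (e * v))).
  by apply: is_derive_eq; rewrite /GRing.scale/=; ring.
have ds : is_derive u (1 : R) (fun v : R => sin (v * a)) (cos (u * a) * a).
  exact: (is_derive1_comp (f := sin) (g := fun v : R => v * a)).
have dc : is_derive u (1 : R) (fun v : R => cos (v * a)) (- sin (u * a) * a).
  exact: (is_derive1_comp (f := cos) (g := fun v : R => v * a)).
rewrite /F.
apply: is_derive_eq.
rewrite /GRing.scale/=.
field.
by rewrite e0' ea0.
Qed.

Let continuous_F (e a : R) : 0 < e -> continuous (F e a).
Proof.
move=> e0 u; apply/differentiable_continuous/derivable1_diffP.
by have [] := is_derive_F e a u e0.
Qed.

Let cvg_F (e a : R) : 0 < e -> F e a u @[u --> +oo] --> (0 : R).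
Proof.
move=> e0.
have ea0 : 0 < e ^+ 2 + a ^+ 2 by rewrite ltr_wpDr ?sqr_ge0// exprn_gt0.
(* [M] bounds the factor of [expR (- (e * u))] in [F] uniformly in [u], since sine and cosine are at
   most 1 in absolute value. *)
pose M := e^-1 + (`|a| + e) / (e ^+ 2 + a ^+ 2).
have FM u : `|F e a u| <= M * expR (- (e * u)).
  rewrite /F -mulrN -mulrDr normrM (ger0_norm (expR_ge0 _)) mulrC.
  rewrite ler_wpM2r ?expR_ge0// (le_trans (ler_normD _ _))//.
  rewrite /M; apply: lerD; first by rewrite normrN gtr0_norm ?invr_gt0.
  rewrite normrM.
  rewrite (@gtr0_norm _ (_^-1)) ?invr_gt0// ler_pM2r ?invr_gt0//.
  rewrite (le_trans (ler_normB _ _))// !normrM (gtr0_norm e0) lerD//.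
  - by rewrite ler_piMr// ler_norml sin_geN1 sin_le1.
  - by rewrite ler_piMr ?(ltW e0)// ler_norml cos_geN1 cos_le1.
have cM : M * expR (- (e * u)) @[u --> +oo] --> (0 : R).
  by rewrite -(mulr0 M); apply: cvgM; [exact: cvg_cst|exact: cvg_expN].
apply: (@squeeze_cvgr _ _ _ _ (fun u => - (M * expR (- (e * u))))
  (fun u => M * expR (- (e * u)))).
- by apply: nearW => u; rewrite -ler_norml FM.
- by rewrite -oppr0; apply: cvgN.
- exact: cM.
Qed.

Lemma ge0_cos1D (x : R) : 0 <= 1 + cos x.
Proof. by rewrite -lerBlDl sub0r cos_geN1. Qed.

Let continuous_abel1 (e a : R) :
  continuous (fun u : R => expR (- (e * u)) * (1 + cos (u * a))).
Proof.
move=> u; apply: cvgM; first exact: continuous_expN.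
by apply: cvgD; [exact: cvg_cst|exact: continuous_cosM].
Qed.

(** Adding 1 to the cosine makes the integrand nonnegative, as the improper fundamental theorem of
    calculus used here demands; [Rintegral_abel_cos] subtracts it again. The value is
    [- F e a 0]. *)
Let integral0y_abel1 (e a : R) : 0 < e ->
  (\int[mu]_(u in `[0%R, +oo[) (expR (- (e * u)) * (1 + cos (u * a)))%:E =
   (e^-1 + e / (e ^+ 2 + a ^+ 2))%:E)%E.
Proof.
move=> e0; rewrite (@ge0_continuous_FTC2y _ _ (F e a) _ 0).
- rewrite /F mulr0 oppr0 expR0 mul0r sin0 cos0 -EFinB; congr EFin.
  by ring.
- by move=> u _; rewrite mulr_ge0 ?expR_ge0 ?ge0_cos1D.
- exact/continuous_subspaceT/continuous_abel1.
- exact: cvg_F.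
- by move=> u _; have [] := is_derive_F e a u e0.
- by apply: cvg_at_right_filter; exact: continuous_F.
- by move=> u _; rewrite derive1E; have [] := is_derive_F e a u e0.
Qed.

Let continuous_expNnorm (e : R) : continuous (fun u : R => expR (- (e * `|u|))).
Proof.
move=> u; apply: (@continuous_comp R R R (@Num.norm R R)
  (fun v => expR (- (e * v)))).
  exact: norm_continuous.
exact: continuous_expN.
Qed.

Let integral_abel1 (e a : R) : 0 < e ->
  (\int[mu]_u (expR (- (e * `|u|)) * (1 + cos (u * a)))%:E =
   (2 * (e^-1 + e / (e ^+ 2 + a ^+ 2)))%:E)%E.
Proof.
move=> e0; rewrite ge0_symfun_integralT.
- rewrite EFinM -(integral0y_abel1 e a e0); congr (_ * _)%E.
  rewrite -set_itvcy; apply: eq_integral => u.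
  by rewrite inE/= in_itv/= andbT => u0; rewrite ger0_norm.
- by move=> u; rewrite mulr_ge0 ?expR_ge0 ?ge0_cos1D.
- move=> u; apply: cvgM; first exact: continuous_expNnorm.
  by apply: cvgD; [exact: cvg_cst|exact: continuous_cosM].
- by move=> u /=; rewrite normrN mulNr cosN.
Qed.

Let integrable_abel1 (e a : R) : 0 < e -> mu.-integrable setT
  (fun u : R => (expR (- (e * `|u|)) * (1 + cos (u * a)))%:E).
Proof.
move=> e0; apply/integrableP; split.
  apply/measurable_EFinP; apply: measurable_funM.
    by apply: continuous_measurable_fun; exact: continuous_expNnorm.
  apply: measurable_funD => //; apply: continuous_measurable_fun.
  exact: continuous_cosM.
under eq_integral => u _.
  rewrite gee0_abs; last by rewrite lee_fin mulr_ge0 ?expR_ge0 ?ge0_cos1D.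
  over.
by rewrite integral_abel1// ltry.
Qed.

(** At [a = 0] the integrand of [integrable_abel1] is twice this exponential and so dominates it. *)
Lemma integrable_abel (e : R) : 0 < e ->
  mu.-integrable setT (fun u : R => (expR (- (e * `|u|)))%:E).
Proof.
move=> e0; apply: (@le_integrable _ _ _ mu setT measurableT _ _ _ _
  (integrable_abel1 e 0 e0)).
- apply/measurable_EFinP; apply: continuous_measurable_fun.
  exact: continuous_expNnorm.
- move=> u _ /=. rewrite lee_fin normrM ler_peMr// mulr0 cos0.
  by rewrite ger0_norm// lerDl.
Qed.

Lemma Rintegral_abel_cos (e a : R) : 0 < e ->
  \int[mu]_u (expR (- (e * `|u|)) * cos (u * a)) =
  2 * e / (e ^+ 2 + a ^+ 2).
Proof.
move=> e0.
have e0' : e != 0 by rewrite gt_eqF.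
have ea0 : e ^+ 2 + a ^+ 2 != 0.
  by rewrite gt_eqF// ltr_wpDr ?sqr_ge0// exprn_gt0.
have E1 : \int[mu]_u (expR (- (e * `|u|)) * (1 + cos (u * a))) =
    2 * (e^-1 + e / (e ^+ 2 + a ^+ 2)) by rewrite /Rintegral integral_abel1.
have E0 : \int[mu]_u (expR (- (e * `|u|))) = 2 / e.
  (* At [a = 0] the factor [1 + cos] equals 2, which isolates the mass of the exponential alone. *)
  have : \int[mu]_u (expR (- (e * `|u|)) * (1 + cos (u * 0))) = 4 / e.
    rewrite /Rintegral integral_abel1//=; field; exact: e0'.
  under eq_Rintegral do rewrite mulr0 cos0.
  rewrite RintegralZr//; last exact: integrable_abel.
  by move=> E; lra.
have -> : \int[mu]_u (expR (- (e * `|u|)) * cos (u * a)) =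
  \int[mu]_u (expR (- (e * `|u|)) * (1 + cos (u * a))) -
  \int[mu]_u (expR (- (e * `|u|))).
  rewrite -RintegralB//.
  - by apply: eq_Rintegral => u _; ring.
  - exact: integrable_abel1.
  - exact: integrable_abel.
by rewrite E1 E0; field; rewrite e0' ea0.
Qed.

Lemma integral_oneDsqrV : (\int[mu]_z ((1 + z ^+ 2)^-1)%:E = pi%:E)%E.
Proof.
rewrite ge0_symfun_integralT.
- rewrite -set_itvcy integral0y_oneDsqr -EFinM; congr EFin.
  by field.
- by move=> z; rewrite invr_ge0 addr_ge0// sqr_ge0.
- exact: continuous_oneDsqrV.
- by move=> z /=; rewrite sqrrN.
Qed.

Lemma integrable_oneDsqrV :
  mu.-integrable setT (fun z : R => ((1 + z ^+ 2)^-1)%:E).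
Proof.
apply/integrableP; split.
  apply/measurable_EFinP; apply: continuous_measurable_fun.
  exact: continuous_oneDsqrV.
under eq_integral => z _.
  rewrite gee0_abs; last by rewrite lee_fin invr_ge0 addr_ge0// sqr_ge0.
  over.
by rewrite integral_oneDsqrV ltry.
Qed.

End abel_kernel.

(** * Pointwise Fourier inversion by Abel summation *)

Section fourier_inversion.
Context {R : realType}.
Local Notation mu := (@lebesgue_measure R).

(** Together with [sin_transform], the real and imaginary parts of the Fourier transform at a real
    frequency (see [fourier_real]); the split keeps the inversion within real integration. *)
Definition cos_transform (g : R -> R) (u : R) : R :=
  \int[mu]_y (cos (u * y) * g y).
Definition sin_transform (g : R -> R) (u : R) : R :=
  \int[mu]_y (sin (u * y) * g y).

Lemma measurable_cos : measurable_fun setT (@cos R).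
Proof. by apply: continuous_measurable_fun; exact: continuous_cos. Qed.

Lemma measurable_sin : measurable_fun setT (@sin R).
Proof. by apply: continuous_measurable_fun; exact: continuous_sin. Qed.

Lemma normr_cos_le1 (x : R) : `|cos x| <= 1.
Proof. by rewrite ler_norml cos_geN1 cos_le1. Qed.

Lemma normr_sin_le1 (x : R) : `|sin x| <= 1.
Proof. by rewrite ler_norml sin_geN1 sin_le1. Qed.

Lemma integrable_bounded_mul d (T : measurableType d)
    (m : {measure set T -> \bar R}) (k f : T -> R) :
  measurable_fun setT k -> (forall x, `|k x| <= 1) ->
  m.-integrable setT (EFin \o f) ->
  m.-integrable setT (fun x => (k x * f x)%:E).
Proof.
move=> mk k1 i_f.
have mf : measurable_fun setT f.
  by apply/measurable_EFinP; exact: measurable_int i_f.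
apply: (@le_integrable _ _ _ m setT measurableT _ _ _ _ i_f).
- by apply/measurable_EFinP; exact: measurable_funM.
- by move=> x _ /=; rewrite lee_fin normrM ler_piMl.
Qed.

Lemma integrable_cosM d (T : measurableType d)
    (m : {measure set T -> \bar R}) (k f : T -> R) :
  measurable_fun setT k -> m.-integrable setT (EFin \o f) ->
  m.-integrable setT (fun x => (cos (k x) * f x)%:E).
Proof.
move=> mk; apply: integrable_bounded_mul => [|x]; last exact: normr_cos_le1.
exact: measurableT_comp measurable_cos mk.
Qed.

Lemma integrable_sinM d (T : measurableType d)
    (m : {measure set T -> \bar R}) (k f : T -> R) :
  measurable_fun setT k -> m.-integrable setT (EFin \o f) ->
  m.-integrable setT (fun x => (sin (k x) * f x)%:E).
Proof.
move=> mk; apply: integrable_bounded_mul => [|x]; last exact: normr_sin_le1.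
exact: measurableT_comp measurable_sin mk.
Qed.

Lemma measurable_mull (a : R) : measurable_fun setT (fun x : R => a * x).
Proof. exact: measurable_funM. Qed.

Lemma measurable_mulr (a : R) : measurable_fun setT (fun x : R => x * a).
Proof. exact: measurable_funM. Qed.

Lemma cos_transformN (g : R -> R) u : cos_transform g (- u) = cos_transform g u.
Proof. by apply: eq_Rintegral => y _; rewrite mulNr cosN. Qed.

Variable g : R -> R.
Hypothesis ig : mu.-integrable setT (EFin \o g).

Let mg : measurable_fun setT g.
Proof. by apply/measurable_EFinP; exact: measurable_int ig. Qed.

Lemma sin_transformN u : sin_transform g (- u) = - sin_transform g u.
Proof.
rewrite /sin_transform -[RHS]mulN1r -RintegralZl//; last first.
  by apply: integrable_sinM => //; exact: measurable_mull.
by apply: eq_Rintegral => y _; rewrite mulNr sinN; ring.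
Qed.

(** The real part of exp(-iux) times the Fourier transform of [g] at [u], that is, of the inversion
    integrand. *)
Let invint x u :=
  cos (u * x) * cos_transform g u + sin (u * x) * sin_transform g u.

Let invintE x u : invint x u = \int[mu]_y (cos (u * (y - x)) * g y).
Proof.
have ic := @integrable_cosM _ _ mu _ _ (measurable_mull u) ig.
have iS := @integrable_sinM _ _ mu _ _ (measurable_mull u) ig.
rewrite /invint /cos_transform /sin_transform -!RintegralZl// -RintegralD//.
- by apply: eq_Rintegral => y _; rewrite mulrBr cosB; ring.
- exact: (integrableZl measurableT (cos (u * x)) ic).
- exact: (integrableZl measurableT (sin (u * x)) iS).
Qed.

(** After the exchange of integrals, the inner one is the Abel kernel's cosine transform at [y - x].
    The substitution y = x + ez then moves [e] from the kernel into the argument of [g]. *)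
Let abel_invint (e x : R) : 0 < e ->
  \int[mu]_u (expR (- (e * `|u|)) * invint x u) =
  \int[mu]_z (2 / (1 + z ^+ 2) * g (x + e * z)).
Proof.
move=> e0.
have e0' : e != 0 by rewrite gt_eqF.
have mE : measurable_fun setT (fun u : R => expR (- (e * `|u|))).
  by apply/measurable_EFinP; exact: measurable_int (integrable_abel e e0).
have mk : measurable_fun setT (fun p : R * R => p.1 * (p.2 - x)).
  by apply: measurable_funM => //; apply: measurable_funB.
pose k (u y : R) := expR (- (e * `|u|)) * (cos (u * (y - x)) * g y).
have k_dom u y : `|k u y| <= expR (- (e * `|u|)) * `|g y|.
  rewrite normrM ger0_norm ?expR_ge0// ler_wpM2l ?expR_ge0//.
  by rewrite normrM ler_piMl// normr_cos_le1.
have m_k : measurable_fun setT (fun p : R * R => k p.1 p.2).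
  apply: measurable_funM; first exact: measurableT_comp mE measurable_fst.
  apply: measurable_funM; first exact: measurableT_comp measurable_cos mk.
  exact: measurableT_comp mg measurable_snd.
(* The exponential supplies the integrability in [u] that the bare cosine lacks. *)
have [_ _ FF] := Rfubini_dominated _ _ _ _ _ mu mu _ _ _ m_k
  (integrable_abel e e0) (integrable_abse ig) k_dom.
transitivity (\int[mu]_u \int[mu]_y k u y).
  apply: eq_Rintegral => u _; rewrite invintE RintegralZl//.
  apply: integrable_cosM; last exact: ig.
  by apply: measurable_funM => //; exact: measurable_funB.
rewrite FF.
transitivity (\int[mu]_y (2 * e / (e ^+ 2 + (y - x) ^+ 2) * g y)).
  apply: eq_Rintegral => y _.
  have ik : mu.-integrable setT
      (fun u => (expR (- (e * `|u|)) * cos (u * (y - x)))%:E).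
    under eq_fun do rewrite mulrC.
    by apply: integrable_cosM; [exact: measurable_mulr|exact: integrable_abel].
  rewrite -(Rintegral_abel_cos e (y - x) e0) -(RintegralZr _ measurableT ik).
  by apply: eq_Rintegral => u _; rewrite /k mulrA.
rewrite (Rintegral_affine R e x _ e0).
- apply: eq_Rintegral => z _; rewrite mulrA; congr (_ * _).
  by field; rewrite !gt_eqF ?ltr_wpDr ?sqr_ge0 ?exprn_gt0 ?ltr01.
- apply: measurable_funM => //; apply: continuous_measurable_fun => y.
  apply: cvgM; first exact: cvg_cst.
  apply: cvgV; first by rewrite gt_eqF// ltr_wpDr ?sqr_ge0// exprn_gt0.
  apply: cvgD; first exact: cvg_cst.
  by apply: (@cvgM _ _ _ _ (fun z => z - x) (fun z => z - x));
    apply: cvgB; [exact: cvg_id|exact: cvg_cst|exact: cvg_id|exact: cvg_cst].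
Qed.

Lemma fourier_inversion (M x : R) : continuous g -> (forall y, `|g y| <= M) ->
  mu.-integrable setT (EFin \o cos_transform g) ->
  mu.-integrable setT (EFin \o sin_transform g) ->
  \int[mu]_u (cos (u * x) * cos_transform g u + sin (u * x) * sin_transform g u)
    = 2 * pi * g x.
Proof.
move=> cg gM ic iS.
(* The Abel parameter runs through the sequence 1/(n+1), so that sequential dominated convergence
   applies. *)
have e0 n : 0 < @harmonic R n by rewrite invr_gt0.
have iI : mu.-integrable setT (EFin \o invint x).
  have := integrableD measurableT
    (integrable_cosM _ _ mu _ _ (measurable_mulr x) ic)
    (integrable_sinM _ _ mu _ _ (measurable_mulr x) iS).
  by apply: eq_integrable => // u _.
have mI : measurable_fun setT (invint x).
  by apply/measurable_EFinP; exact: measurable_int iI.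
have mE n : measurable_fun setT (fun u : R => expR (- (harmonic n * `|u|))).
  apply/measurable_EFinP; exact: measurable_int (integrable_abel _ (e0 n)).
(* Frequency side: the exponential lies between 0 and 1 and tends to 1, so [|invint x|] dominates;
   its integrability comes from that of the two transforms. *)
have cvgL : \int[mu]_u (expR (- (harmonic n * `|u|)) * invint x u)
    @[n --> \oo] --> \int[mu]_u invint x u.
  apply: (@Rdominated_cvg _ _ R mu _ _ (fun u => `|invint x u|)) => //.
  - by move=> n; apply: measurable_funM; [exact: mE|exact: mI].
  - move=> u; rewrite -[X in _ --> X]mul1r; apply: cvgM; last exact: cvg_cst.
    rewrite -[X in _ --> X]expR0; apply: cvg_comp; last exact: continuous_expR.
    rewrite -oppr0; apply: cvgN; rewrite -[X in _ --> X](mul0r `|u|).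
    by apply: cvgM; [exact: cvg_harmonic|exact: cvg_cst].
  - exact: integrable_abse iI.
  - move=> n u; rewrite normrM ler_piMl// ger0_norm ?expR_ge0//.
    by rewrite -expR0 ler_expR oppr_le0 mulr_ge0// ltW.
have iP : mu.-integrable setT (fun z : R => (2 / (1 + z ^+ 2))%:E).
  exact: (integrableZl measurableT 2 integrable_oneDsqrV).
have mP : measurable_fun setT (fun z : R => 2 / (1 + z ^+ 2)).
  by apply/measurable_EFinP; exact: measurable_int iP.
(* Space side: continuity of [g] at [x] gives the pointwise limit, and its bound [M] gives a
   multiple of the Cauchy density as dominating function. *)
have cvgR : \int[mu]_z (2 / (1 + z ^+ 2) * g (x + harmonic n * z))
    @[n --> \oo] --> \int[mu]_z (2 / (1 + z ^+ 2) * g x).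
  apply: (@Rdominated_cvg _ _ R mu _ _ (fun z => 2 / (1 + z ^+ 2) * M)) => //.
  - move=> n; apply: measurable_funM; first exact: mP.
    apply: (measurableT_comp mg); exact: measurable_funD.
  - by apply: measurable_funM; first exact: mP.
  - move=> z; apply: cvgM; first exact: cvg_cst.
    suff xz : x + harmonic n * z @[n --> \oo] --> x.
      exact: cvg_comp xz (cg x).
    rewrite -[X in _ --> X]addr0; apply: cvgD; first exact: cvg_cst.
    rewrite -[X in _ --> X](mul0r z).
    by apply: cvgM; [exact: cvg_harmonic|exact: cvg_cst].
  - exact: (integrableZr measurableT M iP).
  - move=> n z; have P0 : 0 <= 2 / (1 + z ^+ 2).
      by rewrite divr_ge0// addr_ge0// sqr_ge0.
    by rewrite normrM ger0_norm// ler_wpM2l.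
transitivity (\int[mu]_u invint x u) => //.
transitivity (\int[mu]_z (2 / (1 + z ^+ 2) * g x)).
  (* Both limits belong to one and the same sequence, hence coincide. *)
  have /funext abelE n := abel_invint (harmonic n) x (e0 n).
  by move: cvgL; rewrite abelE => cvgL; exact: (cvg_unique _ cvgL cvgR).
rewrite RintegralZr//; congr (_ * _).
rewrite RintegralZl//; last exact: integrable_oneDsqrV.
by rewrite /Rintegral integral_oneDsqrV.
Qed.

End fourier_inversion.

(** * Exchange of expectation and frequency integral *)

Section pricing.
Context {R : realType} {d : measure_display} {T : measurableType d}.
Variable P : probability T R.
Local Notation mu := (@lebesgue_measure R).
(** In the application [W] is exp(r X_T), [Z] is X_T - s and [g] is the damped payoff. *)
Variables (W Z : T -> R) (g : R -> R).
Hypothesis W_ge0 : forall w, 0 <= W w.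
Hypothesis iW : P.-integrable setT (EFin \o W).
Hypothesis mZ : measurable_fun setT Z.
Hypothesis ig : mu.-integrable setT (EFin \o g).
Hypothesis ic : mu.-integrable setT (EFin \o cos_transform g).
Hypothesis iS : mu.-integrable setT (EFin \o sin_transform g).

Let mW : measurable_fun setT W.
Proof. by apply/measurable_EFinP; exact: measurable_int iW. Qed.

Let mc : measurable_fun setT (cos_transform g).
Proof. by apply/measurable_EFinP; exact: measurable_int ic. Qed.

Let mS : measurable_fun setT (sin_transform g).
Proof. by apply/measurable_EFinP; exact: measurable_int iS. Qed.

Let mk : measurable_fun setT (fun p : R * T => p.1 * Z p.2).
Proof.
by apply: measurable_funM => //; exact: measurableT_comp mZ measurable_snd.
Qed.

Let ia : mu.-integrable setT
  (EFin \o (fun u => `|cos_transform g u| + `|sin_transform g u|)).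
Proof.
have := integrableD measurableT (integrable_abse ic) (integrable_abse iS).
by apply: eq_integrable.
Qed.

(* [price_re u w +i* price_im u w] is [W w * exp (i u Z w)] times the conjugate
   of the Fourier transform of [g] at [u]. *)
Definition price_re u w :=
  (cos (u * Z w) * cos_transform g u + sin (u * Z w) * sin_transform g u) * W w.

Definition price_im u w :=
  (sin (u * Z w) * cos_transform g u - cos (u * Z w) * sin_transform g u) * W w.

Let fubini_re := @Rfubini_dominated _ _ _ _ R mu P price_re
  (fun u => `|cos_transform g u| + `|sin_transform g u|) W.

Let fubini_im := @Rfubini_dominated _ _ _ _ R mu P price_im
  (fun u => `|cos_transform g u| + `|sin_transform g u|) W.

Let price_re_dom u w :
  `|price_re u w| <= (`|cos_transform g u| + `|sin_transform g u|) * W w.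
Proof.
rewrite normrM (ger0_norm (W_ge0 w)) ler_wpM2r// (le_trans (ler_normD _ _))//.
by rewrite !normrM lerD// ler_piMl// ?normr_cos_le1 ?normr_sin_le1.
Qed.

Let price_im_dom u w :
  `|price_im u w| <= (`|cos_transform g u| + `|sin_transform g u|) * W w.
Proof.
rewrite normrM (ger0_norm (W_ge0 w)) ler_wpM2r// (le_trans (ler_normB _ _))//.
by rewrite !normrM lerD// ler_piMl// ?normr_cos_le1 ?normr_sin_le1.
Qed.

Let measurable_price_re :
  measurable_fun setT (fun p : R * T => price_re p.1 p.2).
Proof.
apply: measurable_funM; last exact: measurableT_comp mW measurable_snd.
apply: measurable_funD; apply: measurable_funM.
- exact: measurableT_comp measurable_cos mk.
- exact: measurableT_comp mc measurable_fst.
- exact: measurableT_comp measurable_sin mk.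
- exact: measurableT_comp mS measurable_fst.
Qed.

Let measurable_price_im :
  measurable_fun setT (fun p : R * T => price_im p.1 p.2).
Proof.
apply: measurable_funM; last exact: measurableT_comp mW measurable_snd.
apply: measurable_funB; apply: measurable_funM.
- exact: measurableT_comp measurable_sin mk.
- exact: measurableT_comp mc measurable_fst.
- exact: measurableT_comp measurable_cos mk.
- exact: measurableT_comp mS measurable_fst.
Qed.

Lemma integrable_price_re :
  mu.-integrable setT (fun u => (\int[P]_w price_re u w)%:E).
Proof. by have [] := fubini_re measurable_price_re ia iW price_re_dom. Qed.

Lemma integrable_price_im :
  mu.-integrable setT (fun u => (\int[P]_w price_im u w)%:E).
Proof. by have [] := fubini_im measurable_price_im ia iW price_im_dom. Qed.

(** The cosine transform is even and the sine transform odd, so both products in [price_im] change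
    sign with [u], and so does their expectation. *)
Lemma Rintegral_price_im : \int[mu]_u \int[P]_w price_im u w = 0.
Proof.
have [i_im iI _] := fubini_im measurable_price_im ia iW price_im_dom.
apply: Rintegral_odd => [|u].
  by apply/measurable_EFinP; exact: measurable_int iI.
rewrite -[RHS]mulN1r -RintegralZl//.
apply: eq_Rintegral => w _; rewrite /price_im cos_transformN sin_transformN//.
by rewrite mulNr cosN sinN; ring.
Qed.

(** Once the integrals are exchanged, the inner one at fixed [w] is [W w] times the inversion
    integral of [g] at the point [Z w]. *)
Lemma Rintegral_price_re (M : R) : continuous g -> (forall y, `|g y| <= M) ->
  \int[mu]_u \int[P]_w price_re u w = 2 * pi * \int[P]_w (g (Z w) * W w).
Proof.
move=> cg gM.
have mg : measurable_fun setT g by exact: continuous_measurable_fun.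
have igW : P.-integrable setT (fun w => (g (Z w) * W w)%:E).
  apply: (@le_integrable _ _ _ P setT measurableT _ _ _ _
    (integrableZl measurableT M iW)).
    apply/measurable_EFinP; apply: measurable_funM => //.
    exact: measurableT_comp mg mZ.
  move=> w _ /=; rewrite lee_fin !normrM ler_wpM2r// (le_trans (gM _))//.
  exact: ler_norm.
have [_ _ ->] := fubini_re measurable_price_re ia iW price_re_dom.
rewrite -RintegralZl//.
apply: eq_Rintegral => w _; rewrite mulrA.
rewrite -(fourier_inversion _ ig M (Z w) cg gM ic iS) -RintegralZr//.
have := integrableD measurableT
    (integrable_cosM _ _ mu _ _ (measurable_mulr (Z w)) ic)
    (integrable_sinM _ _ mu _ _ (measurable_mulr (Z w)) iS).
by apply: eq_integrable.
Qed.

End pricing.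

(** * Real and imaginary parts of the complex kernels *)

Section complex_kernels.
Context {R : realType}.
Local Notation mu := (@lebesgue_measure R).
Implicit Types f g : R -> R.

Lemma cexp_iM (a b x : R) :
  cexp ('i%C * (a +i* b) * x%:C) =
  (expR (- b * x) * cos (a * x)) +i* (expR (- b * x) * sin (a * x)).
Proof. by rewrite /cexp; simpc. Qed.

Lemma fourier_kernel_real g (u x : R) :
  fourier_kernel g u%:C x = (cos (u * x) * g x) +i* (sin (u * x) * g x).
Proof.
by rewrite /fourier_kernel (cexp_iM u 0) oppr0 mul0r expR0 !mul1r; simpc.
Qed.

Lemma fourier_real g (u : R) :
  fourier g u%:C = cos_transform g u +i* sin_transform g u.
Proof.
by rewrite /fourier /Cintegral; congr (_ +i* _);
  apply: eq_Rintegral => x _; rewrite fourier_kernel_real.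
Qed.

(** Since i(ir - u)x = -rx - iux, the imaginary shift yields exactly the damping factor of [g].
    Equality of kernels, rather than of integrals, transfers integrability too. *)
Lemma fourier_kernel_damped f g (r : R) :
  (forall x, g x = expR (- r * x) * f x) ->
  forall u : R,
    fourier_kernel f ('i%C * r%:C - u%:C) = fourier_kernel g (- u)%:C.
Proof.
move=> gE u; apply/funext => x; rewrite fourier_kernel_real.
have -> : 'i%C * r%:C - u%:C = (- u) +i* r :> R[i] by simpc.
rewrite /fourier_kernel cexp_iM gE; simpc.
by congr (_ +i* _); rewrite -!mulrA mulrCA.
Qed.

Lemma cexp_charfun (r u y : R) :
  cexp ('i%C * (u%:C - 'i%C * r%:C) * y%:C) =
  (cos (u * y) * expR (r * y)) +i* (sin (u * y) * expR (r * y)).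
Proof.
have -> : u%:C - 'i%C * r%:C = u +i* (- r) :> R[i] by simpc.
by rewrite cexp_iM opprK [in X in X +i* _]mulrC [in X in _ +i* X]mulrC.
Qed.

Lemma cexp_phase (u s : R) :
  cexp (- 'i%C * u%:C * s%:C) = cos (u * s) +i* (- sin (u * s)).
Proof. by rewrite /cexp; simpc; rewrite expR0 cosN sinN; simpc. Qed.

End complex_kernels.

(** * The valuation formula *)

Theorem theorem2p2 (R : realType) (d : measure_display)
  (Omega : measurableType d) (P : probability Omega R)
  (T : R) (T_ge0 : 0 <= T)
  (F : R -> set (set Omega)) (F_basis : stochastic_basis T F)
  (F_T : F T = measurable)
  (H : R -> Omega -> R) (H_semimartingale : semimartingale P T F H)
  (H_0 : forall w, H 0 w = 0)
  (h : R -> R) (h_truncation : truncation_function h)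
  (B Hc Hd C : R -> Omega -> R)
  (mu nu : Omega -> {measure set (R * R)%type -> \bar R})
  (H_canonical : canonical_representation P T F h H B Hc Hd C mu nu)
  (nu_exp : rm_bounded_variation P T nu
              (fun _ _ x => if 1 < x then expR x else 0))
  (H_martingale : martingale_condition P T h B C nu)
  (S0 : R) (S0_gt0 : 0 < S0)
  (S : R -> Omega -> R)
  (S_exp : forall t w, 0 <= t <= T -> S t w = S0 * expR (H t w))
  (X : R -> Omega -> R) (X_adapted : adapted T F X)
  (X_functional : path_functional T H X)
  (X_0 : forall w, X 0 w = 0)
  (f : R -> R) (f_measurable : measurable_fun setT f)
  (f_ge0 : forall x, 0 <= f x)
  (s : R) (s_def : s = - ln S0)
  (r : R) (g : R -> R) (g_def : forall x, g x = expR (- r * x) * f x)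
  (g_bounded : [bounded g x | x in setT])
  (g_continuous : continuous g)
  (g_L1 : (@lebesgue_measure R).-integrable setT (fun x => (g x)%:E))
  (M_finite : ('M_P (X T) r < +oo)%E)
  (ghat_L1 : Cintegrable (@lebesgue_measure R) (fun u : R => fourier g u%:C)) :
  let integrand := fun u : R =>
    cexp (- 'i%C * u%:C * s%:C) * charfun P (X T) (u%:C - 'i%C * r%:C) *
    fourier f ('i%C * r%:C - u%:C) in
  [/\ (price P f (X T) s \is a fin_num)%E,
      forall u : R, charfun_defined P (X T) (u%:C - 'i%C * r%:C) /\
                    fourier_defined f ('i%C * r%:C - u%:C),
      Cintegrable (@lebesgue_measure R) integrand &
      (fine (price P f (X T) s))%:C =
        (expR (- r * s) / (2 * pi))%:C *
        Cintegral (@lebesgue_measure R) integrand].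
Proof.
move=> integrand.
have mY : measurable_fun setT (X T).
  move=> _ A mA; rewrite -F_T; apply: X_adapted; first by rewrite T_ge0 lexx.
  by exists A.
have [M gM] : exists M, forall x, `|g x| <= M.
  (* Boundedness is stated for every number strictly above [M], hence the [M + 1]. *)
  case: g_bounded => M [_ gM]; exists (M + 1) => x.
  by apply: gM => //; rewrite ltrDl.
pose W w := expR (r * X T w).
pose Z w := X T w - s.
have W_ge0 w : 0 <= W w by exact: expR_ge0.
have mW : measurable_fun setT W.
  by apply: measurableT_comp => //; exact: measurable_funM.
have mZ : measurable_fun setT Z by exact: measurable_funB.
(* [W] is positive, so finiteness of the moment generating function at [r] is its integrability. *)
have iW : P.-integrable setT (EFin \o W).
  apply/integrableP; split; first exact/measurable_EFinP.
  move: M_finite; rewrite /mmt_gen_fun unlock; congr (_ < _)%E.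
  apply: eq_integral => w _ /=.
  by rewrite ger0_norm// mulrC.
have [ic iS] :
  (@lebesgue_measure R).-integrable setT (EFin \o cos_transform g) /\
  (@lebesgue_measure R).-integrable setT (EFin \o sin_transform g).
  by case: ghat_L1 => i1 i2; split; [move: i1|move: i2];
    apply: eq_integrable => // u _; rewrite fourier_real.
(* Undoing the damping at [Z w] costs exp(r(X_T - s)), which splits into [W w] and the constant
   prefactor of the price. *)
have fZ w : f (Z w) = expR (- r * s) * (g (Z w) * W w).
  rewrite g_def /W mulrAC !mulrA -!expRD.
  rewrite (_ : _ + _ + _ = 0) ?expR0 ?mul1r//.
  by rewrite /Z; ring.
have igW : P.-integrable setT (EFin \o (fun w => g (Z w) * W w)).
  apply: (@le_integrable _ _ _ P setT measurableT _ _ _ _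
    (integrableZl measurableT M iW)).
    apply/measurable_EFinP; apply: measurable_funM => //.
    apply: measurableT_comp mZ; exact: continuous_measurable_fun.
  move=> w _ /=; rewrite lee_fin !normrM ler_wpM2r// (le_trans (gM _))//.
  exact: ler_norm.
have priceE : price P f (X T) s =
    (expR (- r * s) * \int[P]_w (g (Z w) * W w))%:E.
  rewrite -RintegralZl// /Rintegral fineK.
    by rewrite /price unlock; apply: eq_integral => w _; rewrite -fZ.
  exact: (integrable_fin_num measurableT (integrableZl measurableT _ igW)).
have muY u : measurable_fun setT (fun w => u * X T w).
  exact: measurableT_comp (measurable_mull u) mY.
have icW u := integrable_cosM _ _ P _ _ (muY u) iW.
have isW u := integrable_sinM _ _ P _ _ (muY u) iW.
have phiE u : charfun P (X T) (u%:C - 'i%C * r%:C) =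
    (\int[P]_w (cos (u * X T w) * W w)) +i* (\int[P]_w (sin (u * X T w) * W w)).
  by congr (_ +i* _); apply: eq_Rintegral => w _; rewrite cexp_charfun.
(* Merges the two expectations that make up the characteristic function, so that the addition
   formulas can act under a single integral. *)
have phiD u (a b : R) :
    \int[P]_w (a * (cos (u * X T w) * W w) + b * (sin (u * X T w) * W w)) =
    a * \int[P]_w (cos (u * X T w) * W w) +
    b * \int[P]_w (sin (u * X T w) * W w).
  rewrite -(RintegralZl _ measurableT (icW u)).
  rewrite -(RintegralZl _ measurableT (isW u)).
  rewrite (RintegralD measurableT)//.
  - exact: (integrableZl measurableT a (icW u)).
  - exact: (integrableZl measurableT b (isW u)).
(* The phase exp(-ius) turns exp(iuX_T) into exp(iuZ), and the transform of [f] becomes that of [g]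
   at [- u], the conjugate of its value at [u]. *)
have integrandE u : integrand u = (\int[P]_w price_re W Z g u w) +i*
    (\int[P]_w price_im W Z g u w).
  rewrite /integrand cexp_phase phiE.
  rewrite /fourier (fourier_kernel_damped _ _ _ g_def) -/(fourier _ _).
  rewrite fourier_real cos_transformN (sin_transformN _ g_L1).
  simpc; congr (_ +i* _).
  - transitivity (\int[P]_w
      ((cos (u * s) * cos_transform g u - sin (u * s) * sin_transform g u) *
         (cos (u * X T w) * W w) +
       (sin (u * s) * cos_transform g u + cos (u * s) * sin_transform g u) *
         (sin (u * X T w) * W w))); first by rewrite phiD; ring.
    apply: eq_Rintegral => w _; rewrite /price_re /Z mulrBr cosB sinB; ring.
  - transitivity (\int[P]_w
      (- (sin (u * s) * cos_transform g u + cos (u * s) * sin_transform g u) *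
         (cos (u * X T w) * W w) +
       (cos (u * s) * cos_transform g u - sin (u * s) * sin_transform g u) *
         (sin (u * X T w) * W w))); first by rewrite phiD; ring.
    apply: eq_Rintegral => w _; rewrite /price_im /Z mulrBr cosB sinB; ring.
split.
- by rewrite priceE.
- move=> u; split.
  + split.
    * by have := icW u; apply: eq_integrable => // w _; rewrite cexp_charfun.
    * by have := isW u; apply: eq_integrable => // w _; rewrite cexp_charfun.
  + rewrite /fourier_defined (fourier_kernel_damped _ _ _ g_def).
    have mNu := measurable_mull (- u).
    split.
    * have := integrable_cosM _ _ (@lebesgue_measure R) _ _ mNu g_L1.
      by apply: eq_integrable => // w _; rewrite fourier_kernel_real.
    * have := integrable_sinM _ _ (@lebesgue_measure R) _ _ mNu g_L1.
      by apply: eq_integrable => // w _; rewrite fourier_kernel_real.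
- split.
  + have := integrable_price_re P _ _ _ W_ge0 iW mZ ic iS.
    by apply: eq_integrable => // u _; rewrite integrandE.
  + have := integrable_price_im P _ _ _ W_ge0 iW mZ ic iS.
    by apply: eq_integrable => // u _; rewrite integrandE.
(* The imaginary part vanishes, and the [2 * pi] from the inversion cancels the one in the
   prefactor. *)
- rewrite priceE (funext integrandE) /Cintegral/=.
  rewrite Rintegral_price_im//.
  rewrite (Rintegral_price_re P _ _ _ W_ge0 iW mZ g_L1 ic iS M)//.
  simpc; congr (_ +i* _).
  by rewrite [RHS]mulrA divfK// mulf_neq0 ?pnatr_eq0// gt_eqF ?pi_gt0.
Qed.
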